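(* Let $E$ be a Banach space such that its unit ball is the closed convex hull of its extreme points. Suppose that $C\subset E$ is a closed convex subset of $E$ with non-empty interior. If $\sigma$ is a consistent conical bicombing on $C$ (with the metric induced by the norm), then $\sigma(p,q,t)=(1-t)p+tq$ for all $p,q\in C$ and all $t\in[0,1]$.
   Context: The unit ball is the closed ball $\{x\in E:\|x\|\le1\}$. Let $(X,d)$ be a metric space. A (geodesic) bicombing on $X$ is a map $\sigma\colon X\times X\times[0,1]\to X$ such that, writing $\sigma_{pq}(t):=\sigma(p,q,t)$, for all $p,q\in X$ one has $\sigma_{pq}(0)=p$, $\sigma_{pq}(1)=q$, and $d(\sigma_{pq}(t),\sigma_{pq}(s))=|t-s|\cdot d(p,q)$ for all $s,t\in[0,1]$. The bicombing $\sigma$ is conical if $d(\sigma_{pq}(t),\sigma_{p'q'}(t))\le(1-t)\,d(p,p')+t\,d(q,q')$ for all $p,q,p',q'\in X$ and $t\in[0,1]$. It is consistent if for all $p,q\in X$ we have $\sigma_{p'q'}([0,1])\subset\sigma_{pq}([0,1])$ whenever $p'=\sigma_{pq}(s)$ and $q'=\sigma_{pq}(t)$ with $0\le s\le t\le1$. *)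

(* Defs.v *)
From HB Require Import structures.
From mathcomp Require Import all_boot all_order all_algebra.
From mathcomp Require Import all_classical all_reals all_analysis.

Set Implicit Arguments.
Unset Strict Implicit.
Unset Printing Implicit Defensive.

Import Order.TTheory GRing.Theory Num.Theory.
Import numFieldNormedType.Exports.

Local Open Scope classical_set_scope.
Local Open Scope ring_scope.
Local Open Scope convex_scope.

Section subset_metric.
Context {R : realType} {E : normedModType R} (C : set E).

Let dist (x y : C) : R := `|\val x - \val y|.

Let dist_ge0 x y : 0 <= dist x y.
Proof. exact: normr_ge0. Qed.

Let dist_positivity x y : dist x y = 0 -> x = y.
Proof. by move=> /normr0_eq0/subr0_eq/val_inj. Qed.

Let ballEdist (x : C) (d : R) : ball x d = [set y | dist x y < d].
Proof.
by rewrite [LHS](_ : _ = \val @^-1` ball (\val x) d)// -ball_normE.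
Qed.

(* The library only gives the subtype of a set its pseudometric structure. *)
HB.instance Definition _ := PseudoMetric_isMetric.Build R C
  dist_ge0 dist_positivity ballEdist.

Lemma mdist_set_typeE (x y : C) : mdist x y = `|\val x - \val y|.
Proof. by []. Qed.

End subset_metric.

Section bicombing.
Context {R : realType} {X : metricType R}.
Implicit Types (sigma : X -> X -> {i01 R} -> X) (p q : X) (s t : {i01 R}).

Definition bicombing sigma : Prop := forall p q,
  [/\ sigma p q 0%:i01 = p,
      sigma p q 1%:i01 = q &
      forall s t, mdist (sigma p q t) (sigma p q s) =
        `|t%:num - s%:num| * mdist p q].

Definition conical sigma : Prop := forall p q p' q' t,
  mdist (sigma p q t) (sigma p' q' t) <=
    (1 - t%:num) * mdist p p' + t%:num * mdist q q'.

Definition consistent sigma : Prop := forall p q s t, s%:num <= t%:num ->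
  range (sigma (sigma p q s) (sigma p q t)) `<=` range (sigma p q).

End bicombing.

Section convexity.
Context {R : realType} {E : normedModType R}.
Implicit Type A : set E.

Definition unit_ball : set E := [set x | `|x| <= 1].

Definition extreme_points A : set E :=
  [set e | A e /\
    forall (x y : E) (t : R), A x -> A y -> 0 < t < 1 ->
      e = (1 - t) *: x + t *: y -> x = e /\ y = e].

Definition closed_convex_hull A : set E :=
  smallest (fun D : set E => convex_set D /\ closed D) A.

End convexity.

(* Main.v *)
Require Import Defs.
From HB Require Import structures.
From mathcomp Require Import all_boot all_order all_algebra.
From mathcomp Require Import all_classical all_reals all_analysis.
From mathcomp Require Import ring lra.

Set Implicit Arguments.
Unset Strict Implicit.
Unset Printing Implicit Defensive.

Import Order.TTheory GRing.Theory Num.Theory.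
Import numFieldNormedType.Exports.

Local Open Scope classical_set_scope.
Local Open Scope ring_scope.

(** The argument has a local and a global half.

    Locally, conicality is enough.  Suppose that geodesics with displacement a
    are straight near some point, let e be an extreme point of the unit ball
    and let l be positive.  Let u be the deviation from the straight segment,
    at time t, of the geodesic from p to p + a + l e.  Compare it with the
    straight geodesics from p + c l e to p + c l e + a.  The choice c = t - 1
    gives the bound |u + l e| <= l and the choice c = t + 1 gives
    |u - l e| <= l: in both cases the two endpoint distances, averaged with
    weights 1 - t and t, add up to exactly l.  As e is extreme, u = 0
    ([straight_add_extreme]).  So straightness survives the addition of a
    multiple of an extreme point, and the set of unit directions that can be
    added in this way is convex and closed.  It therefore contains the closed
    convex hull of the extreme points, which is the whole unit ball, and all
    short geodesics inside a ball contained in C are straight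
    ([straight_short]).

    Globally, consistency lets straight geodesics be glued: if the segment from
    p to q has its first two thirds and its last two thirds straight, a
    contraction argument at the points dividing it in three shows that it is
    straight itself ([straight_from_thirds]).  Hence the length up to which
    geodesics are straight can be multiplied by 3/2 as long as the segments keep
    a fixed distance to the complement of C ([straight_interior]).  Any two
    points of C are limits of such points, obtained by moving them slightly
    towards an interior point, and straightness passes to limits
    ([straight_everywhere]). *)

(** * Linear identities in a module *)

Section linear_identities.
Context {R : comNzRingType} {E : lmodType R}.

Inductive lin_expr : Type :=
  | LinVar of nat
  | LinAdd of lin_expr & lin_expr
  | LinOpp of lin_expr
  | LinScale of R & lin_expr.

Fixpoint lin_eval (s : seq E) (e : lin_expr) : E :=
  match e with
  | LinVar i => s`_i
  | LinAdd e1 e2 => lin_eval s e1 + lin_eval s e2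
  | LinOpp e1 => - lin_eval s e1
  | LinScale a e1 => a *: lin_eval s e1
  end.

Fixpoint lin_coef (e : lin_expr) (i : nat) : R :=
  match e with
  | LinVar j => (i == j)%:R
  | LinAdd e1 e2 => lin_coef e1 i + lin_coef e2 i
  | LinOpp e1 => - lin_coef e1 i
  | LinScale a e1 => a * lin_coef e1 i
  end.

Lemma lin_evalE s e : lin_eval s e = \sum_(i < size s) lin_coef e i *: s`_i.
Proof.
elim: e => [j|e1 IH1 e2 IH2|e1 IH1|a e1 IH1] /=.
- have [js|sj] := ltnP j (size s).
    rewrite (bigD1 (Ordinal js)) //= eqxx scale1r big1 ?addr0 // => i /eqP ij.
    rewrite (_ : (_ == j) = false) ?scale0r //.
    by apply/eqP => e; apply/ij/val_inj.
  rewrite nth_default // big1 // => i _.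
  by rewrite (_ : (_ == j) = false) ?scale0r // ltn_eqF // (leq_trans _ sj).
- by rewrite IH1 IH2 -big_split; apply: eq_bigr => i _; rewrite scalerDl.
- by rewrite IH1 -sumrN; apply: eq_bigr => i _; rewrite scaleNr.
- by rewrite IH1 scaler_sumr; apply: eq_bigr => i _; rewrite scalerA.
Qed.

Fixpoint same_coefs (e1 e2 : lin_expr) (n : nat) : Prop :=
  if n is m.+1 then lin_coef e1 m = lin_coef e2 m /\ same_coefs e1 e2 m
  else True.

Lemma lin_eval_eq s e1 e2 :
  same_coefs e1 e2 (size s) -> lin_eval s e1 = lin_eval s e2.
Proof.
move=> h; rewrite !lin_evalE; apply: eq_bigr => -[i /= ilt] _; congr (_ *: _).
by elim: (size s) h ilt => // n IH [eqn /IH{}IH]; rewrite ltnS leq_eqVlt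
  => /predU1P[->|/IH].
Qed.

End linear_identities.

Ltac lin_index x s :=
  lazymatch s with
  | cons x _ => constr:(O)
  | cons _ ?s' => let n := lin_index x s' in constr:(S n)
  end.

Ltac lin_reify s t :=
  lazymatch t with
  | ?u + ?v =>
    let eu := lin_reify s u in let ev := lin_reify s v in
    open_constr:(LinAdd eu ev)
  | - ?u => let eu := lin_reify s u in open_constr:(LinOpp eu)
  | ?a *: ?u => let eu := lin_reify s u in open_constr:(LinScale a eu)
  | _ => let n := lin_index t s in open_constr:(LinVar n)
  end.

(** Proves an equation between linear combinations of the vectors listed in s by
    comparing the coefficients of each vector, which are scalar identities. *)
Ltac lin_identity s :=
  lazymatch goal with
  | |- ?u = ?v =>
    let eu := lin_reify s u in
    let ev := lin_reify s v in
    apply: (@lin_eval_eq _ _ s eu ev); rewrite /=; repeat split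
  end; try by field.

(** * Convexity in a normed space *)

Section straight_geodesics.
Context {R : realType} {E : normedModType R}.
Implicit Types (x y u v w a b : E) (r : R).

Lemma i01_point r : 0 <= r -> r <= 1 -> exists t : {i01 R}, t%:num = r.
Proof. by move=> r0 r1; exists (Itv01 r0 r1). Qed.

(** The scaled extreme point l x is the midpoint of l x + u and l x - u, which
    both lie in the ball of radius l. *)
Lemma extreme_unit_ball_rigid x u (l : R) :
  extreme_points unit_ball x -> 0 <= l ->
  `|u + l *: x| <= l -> `|u - l *: x| <= l -> u = 0.
Proof.
move=> [_ x_extreme]; rewrite le_eqVlt => /predU1P[<-|l0].
  by rewrite scale0r addr0 normr_le0 => /eqP.
move=> up um; have l_neq0 : l != 0 by rewrite gt_eqF.
have in_ball y : `|y| <= l -> unit_ball (l^-1 *: y).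
  move=> yl; rewrite /unit_ball/= normrZ ger0_norm ?invr_ge0 ?(ltW l0) //.
  by rewrite ler_pdivrMl ?mulr1.
have half01 : 0 < (2^-1 : R) < 1 by apply/andP; split; lra.
have x_mid : x = (1 - 2^-1) *: (l^-1 *: (u + l *: x))
                 + 2^-1 *: (l^-1 *: - (u - l *: x)).
  lin_identity [:: x; u].
have um' : `|- (u - l *: x)| <= l by rewrite normrN.
have [xE _] := x_extreme _ _ _ (in_ball _ up) (in_ball _ um') half01 x_mid.
have -> : u = l *: (l^-1 *: (u + l *: x)) - l *: x by lin_identity [:: x; u].
by rewrite xE subrr.
Qed.

(** The homothety of centre x and ratio t maps the ball around y onto this ball;
    it is how points of C, possibly on the boundary, are approximated by points
    with some room around them. *)
Lemma ball_shrink_sub (C : set E) x y r (t : R) : convex_set C ->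
  C x -> ball y r `<=` C -> 0 < t <= 1 ->
  ball ((1 - t) *: x + t *: y) (t * r) `<=` C.
Proof.
move=> C_convex Cx yC /andP[t0 t1] z; rewrite -ball_normE /= => zr.
have t_neq0 : t != 0 by rewrite gt_eqF.
(* the preimage of z under the homothety *)
set w := y + t^-1 *: (z - ((1 - t) *: x + t *: y)).
have Cw : C w.
  apply: yC; rewrite -ball_normE /= /w opprD addNKr normrN normrZ.
  by rewrite ger0_norm ?invr_ge0 ?(ltW t0) // ltr_pdivrMl // distrC.
have := C_convex w x (Itv01 (ltW t0) t1) (mem_set Cw) (mem_set Cx).
move/set_mem; congr C.
rewrite [LHS](_ : _ = t *: w + (1 - t) *: x) // /w; lin_identity [:: x; y; z].
Qed.

(** The points at distance at least r from the complement of C form a convex set: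
    the vector h from the centre to z translates x and y as well. *)
Lemma ball_convex_sub (C : set E) x y r (t : {i01 R}) : convex_set C ->
  ball x r `<=` C -> ball y r `<=` C ->
  ball ((1 - t%:num) *: x + t%:num *: y) r `<=` C.
Proof.
move=> C_convex xC yC z; rewrite -ball_normE /= => zr.
set h := z - ((1 - t%:num) *: x + t%:num *: y).
have shift y' : ball y' r `<=` C -> C (y' + h).
  apply; rewrite -ball_normE /= opprD addNKr normrN distrC //.
have /mem_set Cy := shift _ yC; have /mem_set Cx := shift _ xC.
have := C_convex (y + h) (x + h) t Cy Cx; move/set_mem; congr C.
rewrite [LHS](_ : _ = t%:num *: (y + h) + (1 - t%:num) *: (x + h)) // /h.
lin_identity [:: x; y; z].
Qed.

(** * Straight geodesics of a conical bicombing *)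

Section bicombing_on_a_set.
Context {C : set E} {sigma : C -> C -> {i01 R} -> C}.
Hypothesis sigma_bicombing : bicombing sigma.
Hypothesis sigma_conical : conical sigma.
Implicit Types (p q : C) (t : {i01 R}).

Definition straight p q : Prop := forall t,
  \val (sigma p q t) = (1 - t%:num) *: \val p + t%:num *: \val q.

Lemma point_in y : C y -> exists p, \val p = y.
Proof. by move=> Cy; exists (exist _ y (mem_set Cy)). Qed.

Lemma conical_norm p q p' q' t :
  `|\val (sigma p q t) - \val (sigma p' q' t)| <=
  (1 - t%:num) * `|\val p - \val p'| + t%:num * `|\val q - \val q'|.
Proof. exact: sigma_conical. Qed.

Lemma bicombing_norm p q t s :
  `|\val (sigma p q t) - \val (sigma p q s)| =
  `|t%:num - s%:num| * `|\val p - \val q|.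
Proof. by have [_ _] := sigma_bicombing p q; apply. Qed.

Lemma bicombing_start p q t : t%:num = 0 -> sigma p q t = p.
Proof.
move=> t0; have [s0 _ _] := sigma_bicombing p q.
by rewrite -[RHS]s0; congr sigma; apply: val_inj.
Qed.

Lemma bicombing_end p q t : t%:num = 1 -> sigma p q t = q.
Proof.
move=> t1; have [_ s1 _] := sigma_bicombing p q.
by rewrite -[RHS]s1; congr sigma; apply: val_inj.
Qed.

Lemma straight_refl p : straight p p.
Proof.
move=> t; have [z z0] := i01_point (lexx 0) ler01.
have := bicombing_norm p p t z.
rewrite (@bicombing_start p p z) // subrr normr0 mulr0 => /eqP.
rewrite normr_eq0 subr_eq0 => /eqP ->.
lin_identity [:: \val p].
Qed.

(** Conicality makes the geodesic depend continuously on its endpoints. *)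
Lemma straight_limit p q :
  (forall e : R, 0 < e -> exists p' q', [/\ straight p' q',
     `|\val p - \val p'| <= e & `|\val q - \val q'| <= e]) ->
  straight p q.
Proof.
move=> approx t; apply/eqP; rewrite -subr_eq0 -normr_le0.
apply/ler_addgt0Pr => e e0; rewrite add0r.
have [p' [q' [str pp' qq']]] := approx (e / 2) (divr_gt0 e0 (ltr0Sn R 1)).
have t0 : 0 <= t%:num by [].
have t1 : 0 <= 1 - t%:num by rewrite subr_ge0.
rewrite (_ : _ - _ = (\val (sigma p q t) - \val (sigma p' q' t))
  + ((1 - t%:num) *: (\val p' - \val p) + t%:num *: (\val q' - \val q))).
  have bound : (1 - t%:num) * `|\val p - \val p'|
               + t%:num * `|\val q - \val q'| <= e / 2.
    have := ler_wpM2l t1 pp'; have := ler_wpM2l t0 qq'; lra.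
  have := conical_norm p q p' q' t.
  have := ler_normD ((1 - t%:num) *: (\val p' - \val p))
                    (t%:num *: (\val q' - \val q)).
  rewrite !normrZ (ger0_norm t0) (ger0_norm t1).
  rewrite (distrC (\val p')) (distrC (\val q')) => h1 h2.
  apply: (le_trans (ler_normD _ _)); lra.
rewrite str.
lin_identity [:: \val p; \val q; \val p'; \val q'; \val (sigma p q t)].
Qed.

(** The geodesics with displacement a that start at the points
    p + c l x are all within controlled distance of the one from p to q.  The
    range of c is the one swept by t - 1 and t + 1 for t between 0 and 1. *)
Lemma straight_add_extreme p q a x (l : R) :
  extreme_points unit_ball x -> 0 <= l ->
  \val q = \val p + a + l *: x ->
  (forall c : R, -1 <= c <= 2 -> exists p' q', [/\ straight p' q',
     \val p' = \val p + (c * l) *: x & \val q' = \val p' + a]) ->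
  straight p q.
Proof.
move=> x_ext l0 qE parallel t.
have t0 : 0 <= t%:num by [].
have t1 : t%:num <= 1 by [].
have x1 : `|x| <= 1 by case: x_ext.
set u := \val (sigma p q t) - ((1 - t%:num) *: \val p + t%:num *: \val q).
have bound (c : R) : -1 <= c <= 2 ->
    `|u + ((t%:num - c) * l) *: x|
    <= ((1 - t%:num) * `|c| + t%:num * `|1 - c|) * l.
  move=> /parallel[p' [q' [str p'E q'E]]].
  have := conical_norm p q p' q' t; rewrite str.
  have -> : \val p - \val p' = (- (c * l)) *: x.
    by rewrite p'E; lin_identity [:: \val p; x].
  have -> : \val q - \val q' = ((1 - c) * l) *: x.
    by rewrite q'E p'E qE; lin_identity [:: \val p; a; x].
  have -> : \val (sigma p q t) - ((1 - t%:num) *: \val p' + t%:num *: \val q')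
            = u + ((t%:num - c) * l) *: x.
    rewrite /u q'E p'E qE.
    lin_identity [:: \val p; a; x; \val (sigma p q t)].
  rewrite !normrZ normrN !normrM (ger0_norm l0) => /le_trans; apply.
  rewrite [leRHS]mulrDl; apply: lerD; rewrite -[leRHS]mulrA;
    apply: ler_wpM2l => //.
    by rewrite ler_piMr // mulr_ge0.
  by rewrite ler_piMr // mulr_ge0.
suff : u = 0 by move/eqP; rewrite /u subr_eq0 => /eqP.
apply: (extreme_unit_ball_rigid x_ext l0).
(* (1 - t) |c| + t |1 - c| equals 1 for both c = t - 1 and c = t + 1 *)
- have /bound : -1 <= t%:num - 1 <= 2 by apply/andP; split; lra.
  rewrite ler0_norm ?ger0_norm; try lra.
  rewrite (_ : (_ - _) * l = l); last by ring.
  by move/le_trans; apply; rewrite [leLHS](_ : _ = l) //; ring.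
- have /bound : -1 <= t%:num + 1 <= 2 by apply/andP; split; lra.
  rewrite ger0_norm ?ler0_norm; try lra.
  rewrite (_ : _ *: x = - (l *: x)); last by lin_identity [:: x].
  by move/le_trans; apply; rewrite [leLHS](_ : _ = l) //; ring.
Qed.

(** * Straightness of short geodesics *)

Section local_straightness.
Context {c : E} {r : R}.
Hypothesis ball_in_C : ball c r `<=` C.

(** The number k bounds the length of a path, made of steps along vectors of the
    unit ball, that leads from 0 to a; it may exceed the norm of a.  The margin
    2 k is what an induction on such paths needs: adding l x to a displaces the
    comparison geodesics by at most 2 l. *)
Definition straight_displacement (k : R) a : Prop := `|a| <= k /\
  forall p q, `|\val p - c| + 2 * k < r -> \val q = \val p + a -> straight p q.

Lemma straight_displacement0 : straight_displacement 0 0.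
Proof.
split=> [|p q _]; first by rewrite normr0.
by rewrite addr0 => /val_inj ->; exact: straight_refl.
Qed.

Lemma point_in_ball y : `|y - c| < r -> exists p, \val p = y.
Proof.
by move=> yr; apply: point_in; apply: ball_in_C; rewrite -ball_normE /= distrC.
Qed.

Lemma straight_displacement_extreme k a x (l : R) :
  extreme_points unit_ball x -> 0 <= l ->
  straight_displacement k a -> straight_displacement (k + l) (a + l *: x).
Proof.
move=> x_ext l0 [ak a_str]; have x1 : `|x| <= 1 by case: x_ext.
have lx : `|l *: x| <= l by rewrite normrZ ger0_norm // ler_piMr.
split=> [|p q pr qE]; first by apply: (le_trans (ler_normD _ _)); exact: lerD.
apply: (straight_add_extreme x_ext l0 (a := a)) => [|d /andP[d1 d2]].
  by rewrite qE addrA.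
have dl : `|(d * l) *: x| <= 2 * l.
  rewrite -scalerA normrZ; apply: ler_pM => //.
  by rewrite ler_norml; apply/andP; split; lra.
have pd : `|\val p + (d * l) *: x - c| <= `|\val p - c| + 2 * l.
  by rewrite addrAC; apply: (le_trans (ler_normD _ _)); rewrite lerD2l.
have k0 : 0 <= k by exact: le_trans ak.
have [p' p'E] : exists p', \val p' = \val p + (d * l) *: x.
  by apply: point_in_ball; lra.
have [q' q'E] : exists q', \val q' = \val p' + a.
  apply: point_in_ball; rewrite addrAC.
  by apply: (le_lt_trans (ler_normD _ _)); rewrite p'E; lra.
exists p', q'; split => //; apply: a_str => //; rewrite p'E; lra.
Qed.

(** Stating the stability for all a at once is what makes this set convex: a
    step along a convex combination of w1 and w2 is a step along w1 followed by
    a step along w2, and the lengths l t and l (1 - t) add up to l. *)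
Definition admissible_direction : set E := [set w | `|w| <= 1 /\
  forall (k l : R) a, 0 <= l ->
    straight_displacement k a -> straight_displacement (k + l) (a + l *: w)].

Lemma admissible_direction_convex : convex_set admissible_direction.
Proof.
move=> w1 w2 t /set_mem[w1_le1 w1_str] /set_mem[w2_le1 w2_str]; apply/mem_set.
have t0 : 0 <= t%:num by [].
have t1 : 0 <= 1 - t%:num by rewrite subr_ge0.
rewrite [conv _ _ _](_ : _ = t%:num *: w1 + (1 - t%:num) *: w2) //; split.
  apply: (le_trans (ler_normD _ _)); rewrite !normrZ !ger0_norm //.
  have := ler_wpM2l t0 w1_le1; have := ler_wpM2l t1 w2_le1; lra.
move=> k l a l0 a_str.
have := w2_str _ _ _ (mulr_ge0 l0 t1) (w1_str _ _ _ (mulr_ge0 l0 t0) a_str).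
congr straight_displacement; first by ring.
lin_identity [:: a; w1; w2].
Qed.

Lemma admissible_direction_closed : closed admissible_direction.
Proof.
move=> w w_lim.
have approx (e : R) : 0 < e ->
    exists w', admissible_direction w' /\ `|w - w'| < e.
  move=> e0; have [w' [w'_adm]] := w_lim _ (nbhsx_ballx w e e0).
  by rewrite -ball_normE /= => ww'; exists w'.
have w_le1 : `|w| <= 1.
  apply/ler_addgt0Pr => e e0; have [w' [[w'_le1 _] ww']] := approx e e0.
  by have := ler_normD w' (w - w'); rewrite addrC subrK; lra.
split=> // k l a l0 a_str; have [ak _] := a_str; split.
  apply: (le_trans (ler_normD _ _)); rewrite normrZ ger0_norm //.
  by rewrite lerD // ler_piMr.
move=> p q pr qE; apply: straight_limit => e e0.
have l1 : 0 < l + 1 by lra.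
have [w' [[w'_le1 w'_str] ww']] := approx (e / (l + 1)) (divr_gt0 e0 l1).
have [kl_bound kl_str] := w'_str k l a l0 a_str.
have [q' q'E] : exists q', \val q' = \val p + (a + l *: w').
  apply: point_in_ball; rewrite addrAC.
  apply: (le_lt_trans (ler_normD _ _)).
  have := le_trans (normr_ge0 _) kl_bound; lra.
exists p, q'; split; [exact: kl_str | by rewrite subrr normr0 ltW |].
rewrite q'E qE (_ : _ - _ = l *: (w - w')); last first.
  lin_identity [:: \val p; a; w; w'].
rewrite normrZ ger0_norm //; move: ww'; rewrite ltr_pdivlMr // => ww'.
have := normr_ge0 (w - w'); nra.
Qed.

Hypothesis unit_ballE :
  @unit_ball R E = closed_convex_hull (extreme_points unit_ball).

Lemma unit_ball_admissible : unit_ball `<=` admissible_direction.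
Proof.
rewrite unit_ballE; apply: smallest_sub.
  by split; [exact: admissible_direction_convex
            | exact: admissible_direction_closed].
move=> x x_ext; split=> [|k l a]; first by case: x_ext.
exact: straight_displacement_extreme.
Qed.

(** Apply admissibility of the direction of q - p to the displacement 0. *)
Lemma straight_short p q :
  `|\val p - c| + 2 * `|\val q - \val p| < r -> straight p q.
Proof.
set v := \val q - \val p => pr.
have [w_le1 vE] : unit_ball (`|v|^-1 *: v) /\ `|v| *: (`|v|^-1 *: v) = v.
  have [->|v0] := eqVneq v 0.
    by rewrite /unit_ball/= !scaler0 normr0.
  have nv0 : `|v| != 0 by rewrite normr_eq0.
  rewrite /unit_ball/= normrZ normfV normr_id mulVf //.
  by rewrite scalerA mulfV // scale1r.
have [_ w_str] := unit_ball_admissible w_le1.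
have [_] := w_str _ _ _ (normr_ge0 v) straight_displacement0.
rewrite vE !add0r; apply => //; by rewrite /v addrC subrK.
Qed.

End local_straightness.

(** * From short to long geodesics *)

Section long_geodesics.
Hypothesis sigma_consistent : consistent sigma.

(** Consistency only compares images.  The parametrizations agree because a
    point of a geodesic is determined by its distances to two points between
    which it lies. *)
Lemma consistent_reparametrization p q (s t l m : {i01 R}) :
  s%:num <= t%:num -> m%:num = (1 - l%:num) * s%:num + l%:num * t%:num ->
  sigma (sigma p q s) (sigma p q t) l = sigma p q m.
Proof.
move=> st mE.
have [v _ vE] := @sigma_consistent p q s t st _ (ex_intro2 _ _ l I erefl).
have [z z0] := i01_point (lexx 0) ler01.
have [one one1] := i01_point ler01 (lexx 1).
apply: val_inj; apply/eqP; rewrite -subr_eq0 -normr_eq0 -vE bicombing_norm.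
have := bicombing_norm (sigma p q s) (sigma p q t) l z.
have := bicombing_norm (sigma p q s) (sigma p q t) one l.
rewrite (@bicombing_start _ _ z) // (@bicombing_end _ _ one) // -vE.
rewrite !bicombing_norm.
have [->|d0] := eqVneq `|\val p - \val q| 0; first by rewrite !mulr0.
rewrite !mulrA => /(mulIf d0) h1 /(mulIf d0) h2.
rewrite mulf_eq0 (negPf d0) orbF normr_eq0 subr_eq0 mE; apply/eqP.
have l0 : 0 <= l%:num by [].
have l1 : 0 <= 1 - l%:num by rewrite subr_ge0.
move: h1 h2; rewrite z0 one1 subr0 (ger0_norm l0) (ger0_norm l1).
rewrite (distrC s%:num) (ger0_norm (_ : 0 <= t%:num - s%:num)) ?subr_ge0 //.
(* v - s and t - v are bounded by l (t - s) and (1 - l) (t - s), so v = m *)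
have := ler_norm (v%:num - s%:num); have := ler_norm (t%:num - v%:num); nra.
Qed.

(** Let s and u be the points of the geodesic from p to q at times 1/3 and 2/3.
    Then p1 and s are the midpoints of the geodesics from p to q1 and to u, so
    conicality gives |p1 - s| <= |q1 - u| / 2; symmetrically
    |q1 - u| <= |p1 - s| / 2.  Both distances vanish, and each half of the
    geodesic lies in one of the two straight pieces. *)
Lemma straight_from_thirds p q p1 q1 :
  \val p1 = \val p + 3^-1 *: (\val q - \val p) ->
  \val q1 = \val p + (2 / 3) *: (\val q - \val p) ->
  straight p q1 -> straight p1 q -> straight p q.
Proof.
move=> p1E q1E str_pq1 str_p1q.
have [z z0] := i01_point (lexx 0) ler01.
have [one one1] := i01_point ler01 (lexx 1).
have [h hE] : exists t : {i01 R}, t%:num = 2^-1 by apply: i01_point; lra.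
have [s sE] : exists t : {i01 R}, t%:num = 3^-1 by apply: i01_point; lra.
have [u uE] : exists t : {i01 R}, t%:num = 2 / 3 by apply: i01_point; lra.
have left_part l m : m%:num = l%:num * (2 / 3) ->
    sigma p (sigma p q u) l = sigma p q m.
  move=> mE; rewrite -{1}(@bicombing_start p q z) //.
  by apply: consistent_reparametrization; rewrite ?z0 ?uE; lra.
have right_part l m : m%:num = (1 - l%:num) * 3^-1 + l%:num ->
    sigma (sigma p q s) q l = sigma p q m.
  move=> mE; rewrite -{2}(@bicombing_end p q one) //.
  by apply: consistent_reparametrization; rewrite ?one1 ?sE; lra.
have p1_mid : \val p1 = \val (sigma p q1 h).
  rewrite str_pq1 q1E p1E hE; lin_identity [:: \val p; \val q].
have q1_mid : \val q1 = \val (sigma p1 q h).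
  rewrite str_p1q q1E p1E hE; lin_identity [:: \val p; \val q].
have ds : `|\val p1 - \val (sigma p q s)|
          <= 2^-1 * `|\val q1 - \val (sigma p q u)|.
  rewrite {1}p1_mid -(left_part h) ?hE ?sE; last by field.
  apply: (le_trans (conical_norm _ _ _ _ _)).
  by rewrite subrr normr0 mulr0 add0r hE.
have du : `|\val q1 - \val (sigma p q u)|
          <= 2^-1 * `|\val p1 - \val (sigma p q s)|.
  rewrite {1}q1_mid -(right_part h) ?hE ?uE; last by field.
  apply: (le_trans (conical_norm _ _ _ _ _)).
  rewrite subrr normr0 mulr0 addr0 hE; lra.
have sigma_s : sigma p q s = p1.
  apply/val_inj/eqP; rewrite eq_sym -subr_eq0 -normr_le0; lra.
have sigma_u : sigma p q u = q1.
  apply/val_inj/eqP; rewrite eq_sym -subr_eq0 -normr_le0; lra.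
move=> t; have [t_small|t_large] := lerP t%:num (2 / 3).
  have [l lE] : exists l : {i01 R}, l%:num = t%:num * (3 / 2).
    have t0 : 0 <= t%:num by [].
    by apply: i01_point; lra.
  rewrite -(left_part l t) ?sigma_u ?str_pq1 ?q1E ?lE; last by field.
  lin_identity [:: \val p; \val q].
have [l lE] : exists l : {i01 R}, l%:num = (t%:num - 3^-1) * (3 / 2).
  have t1 : t%:num <= 1 by [].
  by apply: i01_point; lra.
rewrite -(right_part l t) ?sigma_s ?str_p1q ?p1E ?lE; last by field.
lin_identity [:: \val p; \val q].
Qed.

Hypothesis C_convex : convex_set C.
Hypothesis unit_ballE :
  @unit_ball R E = closed_convex_hull (extreme_points unit_ball).

(** The induction bound grows linearly instead of by the factor 3/2 granted by
    [straight_from_thirds], which is possible since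
    (2/3) (n + 3) <= n + 2; the unit r / 8 makes the case n = 0 an instance of
    [straight_short]. *)
Lemma straight_interior r p q : 0 < r ->
  ball (\val p) r `<=` C -> ball (\val q) r `<=` C -> straight p q.
Proof.
move=> r0.
suff main n p' q' : ball (\val p') r `<=` C -> ball (\val q') r `<=` C ->
    `|\val q' - \val p'| <= n.+2%:R * (r / 8) -> straight p' q'.
  move=> pr qr; apply: (main (Num.bound (`|\val q - \val p| / (r / 8)))) => //.
  have r8 : 0 < r / 8 by lra.
  rewrite -ler_pdivrMr // ltW //.
  apply: (lt_trans (archi_boundP _)); first by rewrite divr_ge0 // ltW.
  by rewrite ltr_nat ltnS leqnSn.
elim: n p' q' => [|n IH] p' q' p'C q'C.
  move=> pq; apply: (straight_short p'C) => //.
  by rewrite subrr normr0 add0r; lra.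
move=> pq.
have third (x : {i01 R}) :
    exists m : C, \val m = \val p' + x%:num *: (\val q' - \val p')
              /\ ball (\val m) r `<=` C.
  have sub := ball_convex_sub (t := x) C_convex p'C q'C.
  have [m mE] : exists m : C,
      \val m = (1 - x%:num) *: \val p' + x%:num *: \val q'.
    by exact/point_in/sub/ballxx.
  exists m; rewrite mE; split=> //; lin_identity [:: \val p'; \val q'].
have [s sE] : exists t : {i01 R}, t%:num = 3^-1 by apply: i01_point; lra.
have [u uE] : exists t : {i01 R}, t%:num = 2 / 3 by apply: i01_point; lra.
have [p1 [p1E p1C]] := third s; have [q1 [q1E q1C]] := third u.
rewrite sE in p1E; rewrite uE in q1E.
have shorter : (2 / 3) * `|\val q' - \val p'| <= n.+2%:R * (r / 8).
  have : (2 / 3) * (n.+3%:R * (r / 8)) <= n.+2%:R * (r / 8).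
    have nr : 0 <= n%:R * r by rewrite mulr_ge0 ?ler0n // ltW.
    by rewrite -[n.+3]addn3 -[n.+2]addn2 !natrD; lra.
  by apply: le_trans; rewrite ler_wpM2l //; lra.
have n23 : `|2 / 3 : R| = 2 / 3 by rewrite ger0_norm //; lra.
apply: (straight_from_thirds p1E q1E); apply: IH => //.
- by rewrite q1E addrC addKr normrZ n23.
- have -> : \val q' - \val p1 = (2 / 3) *: (\val q' - \val p').
    by rewrite p1E; lin_identity [:: \val p'; \val q'].
  by rewrite normrZ n23.
Qed.

Lemma straight_everywhere p q : C° !=set0 -> straight p q.
Proof.
move=> [c /nbhs_ballP[r /= r0 cC]]; apply: straight_limit => e e0.
set N := e + `|\val p - c| + `|\val q - c|.
have N0 : 0 < N by rewrite /N -addrA ltr_wpDr // addr_ge0.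
have [tau [t0 t1 tauN]] : exists tau, [/\ 0 < tau, tau <= 1 & tau * N <= e].
  exists (e / N); rewrite divr_gt0 // ler_pdivrMr // mul1r divfK ?gt_eqF //.
  by rewrite /N -addrA lerDl addr_ge0.
have approx (y : C) : `|\val y - c| <= N ->
    exists y' : C, `|\val y - \val y'| <= e /\ ball (\val y') (tau * r) `<=` C.
  move=> yN; have t01 : 0 < tau <= 1 by rewrite t0.
  have sub := ball_shrink_sub C_convex (set_mem (valP y)) cC t01.
  have [y' y'E] : exists y' : C,
      \val y' = (1 - tau) *: \val y + tau *: c.
    by apply: point_in; apply: sub; apply: ballxx; rewrite mulr_gt0.
  exists y'; rewrite y'E; split=> //.
  have -> : \val y - ((1 - tau) *: \val y + tau *: c) = tau *: (\val y - c).
    lin_identity [:: \val y; c].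
  rewrite normrZ gtr0_norm //; apply: le_trans tauN.
  by rewrite ler_wpM2l // ltW.
have [p' [pp' p'C]] : exists p', `|\val p - \val p'| <= e
    /\ ball (\val p') (tau * r) `<=` C.
  by apply: approx; rewrite /N; have := normr_ge0 (\val q - c); lra.
have [q' [qq' q'C]] : exists q', `|\val q - \val q'| <= e
    /\ ball (\val q') (tau * r) `<=` C.
  by apply: approx; rewrite /N; have := normr_ge0 (\val p - c); lra.
exists p', q'; split=> //.
by apply: (straight_interior (r := tau * r)) => //; rewrite mulr_gt0.
Qed.

End long_geodesics.

End bicombing_on_a_set.
End straight_geodesics.

Theorem theorem1p5 (R : realType) (E : completeNormedModType R)
    (hE : @unit_ball R E = closed_convex_hull (extreme_points unit_ball))
    (C : set E) (C_closed : closed C) (C_convex : convex_set C)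
    (C_interior : C° !=set0)
    (sigma : C -> C -> {i01 R} -> C)
    (sigma_bicombing : bicombing sigma)
    (sigma_conical : conical sigma)
    (sigma_consistent : consistent sigma) :
  forall (p q : C) (t : {i01 R}),
    \val (sigma p q t) = (1 - t%:num) *: \val p + t%:num *: \val q.
Proof. by move=> p q; apply: straight_everywhere. Qed.
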